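(* Let $0<\alpha<1+\sqrt{2}$. Then there exists $K=K(\alpha)$ such that any distance-regular graph $\Gamma$ with diameter $D$ at least three, valency $k\geq K$, $a_1\geq 2$ and smallest eigenvalue at most $-1-\frac{b_1}{\alpha}$ is one of the following graphs: (I) $D=3$ and (a) $\Gamma$ is the icosahedron, with intersection array $\{5, 2, 1; 1, 2, 5\}$; or (b) $\Gamma$ is the Johnson graph $J(6,3)$, with intersection array $\{9, 4, 1; 1, 4, 9\}$; or (c) $\Gamma$ is the distance-2 graph of the halved 6-cube, with intersection array $\{15, 8, 1; 1, 8, 15\}$; or (d) $\Gamma$ is the Gosset graph, with intersection array $\{27, 16, 1; 1, 16, 27\}$; (IV) $D=4$ and $\Gamma$ is the Conway-Smith graph, with intersection array $\{10, 6, 4, 1; 1, 2, 6, 10\}$.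
   Context: All graphs are finite, undirected and simple. For a connected graph $\Gamma$ with distance function $d$ and diameter $D$, let $\Gamma_i(x)$ be the set of vertices at distance $i$ from $x$. A connected graph $\Gamma$ of diameter $D$ is distance-regular if there are integers $b_i,c_i$ ($0\le i\le D$), with $b_D=0=c_0$, such that for any vertices $x,y$ with $d(x,y)=i$ there are precisely $c_i$ neighbours of $y$ in $\Gamma_{i-1}(x)$ and $b_i$ neighbours of $y$ in $\Gamma_{i+1}(x)$. Its valency is $k=b_0$; $a_i:=k-b_i-c_i$; its intersection array is $\{b_0,\dots,b_{D-1};c_1,\dots,c_D\}$. Eigenvalues of a graph are those of its adjacency matrix. $J(6,3)$ has as vertices the 3-subsets of a 6-set, adjacent when they meet in 2 elements. The halved 6-cube has as vertices the even-weight vectors of $\{0,1\}^6$, adjacent when at Hamming distance 2; the distance-2 graph of a graph has the same vertices, adjacent when at distance 2 in the original graph. The Gosset graph (56 vertices) and the Conway-Smith graph (63 vertices) are the unique distance-regular graphs with the intersection arrays given for them. *)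

(* Defs.v *)
From mathcomp Require Import all_boot all_order all_algebra.
From mathcomp Require Import reals.

Set Implicit Arguments.
Unset Strict Implicit.
Unset Printing Implicit Defensive.

Import GRing.Theory Num.Theory.

Section Graphs.
Variables (T : finType) (e : rel T).

Definition walk_of_length (n : nat) (x y : T) : bool :=
  [exists p : n.-tuple T, path e x p && (last x p == y)].

(* Shortest walks have fewer than #|T| edges; unreachable pairs get #|T|. *)
Definition dist (x y : T) : nat :=
  find (fun n => walk_of_length n x y) (iota 0 #|T|).

Definition diameter : nat := \max_(x : T) \max_(y : T) dist x y.

Record connected_graph : Prop := ConnectedGraph {
  graph_sym : symmetric e;
  graph_irr : irreflexive e;
  graph_nonempty : 0 < #|T|;
  graph_connect : forall x y : T, connect e x y
}.

(* The values of b and c above the diameter are irrelevant. *)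
Record distance_regular (b c : nat -> nat) : Prop := DistanceRegular {
  drg_connected : connected_graph;
  drg_bD : b diameter = 0;
  drg_c0 : c 0 = 0;
  drg_b : forall x y : T,
    #|[set z | e y z && (dist x z == (dist x y).+1)]| = b (dist x y);
  drg_c : forall x y : T,
    #|[set z | e y z && ((dist x z).+1 == dist x y)]| = c (dist x y)
}.

Definition has_intersection_array (bs cs : seq nat) : Prop :=
  exists b c : nat -> nat,
    [/\ distance_regular b c,
        bs = [seq b i | i <- iota 0 diameter] &
        cs = [seq c i | i <- iota 1 diameter]].

Definition distance_graph (i : nat) : rel T := fun x y => dist x y == i.

Definition adjacency_matrix (R : realType) : 'M[R]_#|T| :=
  (\matrix_(i, j) (e (enum_val i) (enum_val j))%:R)%R.

Definition smallest_eigenvalue (R : realType) (theta : R) : Prop :=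
  eigenvalue (adjacency_matrix R) theta /\
  forall mu : R, eigenvalue (adjacency_matrix R) mu -> (theta <= mu)%R.

End Graphs.

(* For i at most the diameter, the subtraction is not truncated: b i + c i
   counts some of the b 0 neighbours of a vertex. *)
Definition a_number (b c : nat -> nat) (i : nat) : nat := b 0 - b i - c i.

Definition graph_iso (T U : finType) (e : rel T) (f : rel U) : Prop :=
  exists2 h : T -> U, bijective h & forall x y, f (h x) (h y) = e x y.

(* (s, None) are the two poles, (s, Some i) the pentagon next to the pole
   (s, None), and (~~ s, v) is the antipode of (s, v). *)
Definition icosahedron (u v : bool * option 'Z_5) : bool :=
  match u, v with
  | (_, None), (_, None) => false
  | (s, None), (t, Some _) | (s, Some _), (t, None) => s == t
  | (s, Some i), (t, Some j) =>
      if s == t then (i - j == 1)%R || (j - i == 1)%R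
      else (i - j == 2)%R || (j - i == 2)%R
  end.

Definition johnson_6_3 : rel {A : {set 'I_6} | #|A| == 3} :=
  fun A B => #|val A :&: val B| == 2.

Definition halved_6_cube :
    rel {v : {ffun 'I_6 -> bool} | ~~ odd #|[set i | v i]|} :=
  fun u v => #|[set i | val u i != val v i]| == 2.

(* The Gosset graph and the Conway-Smith graph are the unique distance-regular
   graphs with these intersection arrays. *)
Definition is_gosset (T : finType) (e : rel T) : Prop :=
  #|T| = 56 /\ has_intersection_array e [:: 27; 16; 1] [:: 1; 16; 27].

Definition is_conway_smith (T : finType) (e : rel T) : Prop :=
  #|T| = 63 /\ has_intersection_array e [:: 10; 6; 4; 1] [:: 1; 2; 6; 10].

(* Main.v *)
Require Import Defs.
From mathcomp Require Import all_boot all_order all_algebra.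
From mathcomp Require Import reals.
From mathcomp Require Import zify ring lra.

Set Implicit Arguments.
Unset Strict Implicit.
Unset Printing Implicit Defensive.

Import Order.TTheory GRing.Theory Num.Theory.

(** For large valency no graph satisfies the hypotheses, so the constant K is
    chosen beyond the valencies of all the listed graphs and the proof is by
    contradiction.  K can even be taken independent of alpha.

    Write k = b_0, and let G_x be the graph on the neighbours of x in
    which two of them are joined when they are at distance 2; it has k
    vertices and is b_1-regular.  The cosines u_i of theta form a positive
    semidefinite matrix u_(d(y,z)) ([cosine_matrix]).  Evaluating it on vectors
    supported on x and its neighbours shows that alpha I + A(G_x) is positive
    semidefinite ([local_form]): every eigenvalue of G_x is at least -alpha, which
    exceeds -1 - sqrt 2.

    Suppose first that a_1 = k - 1 - b_1 is bounded.  Since 2 <= a_1, the local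
    graph at x contains two paths with two edges, and when k is large two of
    them are at distance at least 2 from each other.  The path on three vertices
    has eigenvalue sqrt 2, and further edges can only help, so on the difference
    of the positive eigenvectors of the two paths the form of [local_form] gives
    sqrt 2 <= alpha - 1, a contradiction ([sqrt2_le_of_far_paths]).

    So it is enough to bound a_1 by an absolute constant ([a1_bounded]), for
    which it suffices that the least eigenvalue of G_x is at least -5/2.  As the
    diameter is at least 3, c_2 <= b_1, whence k <= 3 b_1 + 2 and G_x is dense.  A
    dense regular graph with such a least eigenvalue is, up to a bounded number
    of errors per vertex, a disjoint union of cliques: it has no induced star
    with 8 leaves, so by Ramsey neighbourhoods contain large cliques C; a vertex
    is joined to few or to almost all vertices of C ([clique_split]); the
    vertices of the second kind form a cluster, almost a clique, to which other
    vertices have few neighbours ([cluster_missing], [cluster_outside]); counting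
    edges leaving the cluster shows that its size is b_1 up to a constant
    ([cluster_large]).  So each vertex v has a cluster which is its neighbourhood
    up to a constant, and any other vertex shares with v either almost all or
    almost none of its neighbours ([local_clusters]).

    Finally let a_1 be large.  Take x adjacent to y, then q adjacent to both x
    and y and outside the cluster of x in G_y.  Almost every vertex x' of that
    cluster is adjacent to q and lies in the cluster of x in G_q.  Then x and x'
    are at distance 2 and have k - b_1 common neighbours in each of the
    neighbourhoods of y and of q, up to constants, while these two sets overlap
    in only k - 2 b_1 vertices.  So c_2 >= k - O(1); together with c_2 <= b_1
    this bounds a_1. *)

(** * Graph distance *)

Section Metric.
Variables (T : finType) (e : rel T).
Hypothesis eG : connected_graph e.
Implicit Types x y z : T.

Lemma walkP n x y :
  reflect (exists p, [/\ size p = n, path e x p & last x p = y])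
          (walk_of_length e n x y).
Proof.
apply: (iffP existsP) => [[p /andP[pp /eqP lp]]|[p [sp pp lp]]].
  by exists p; rewrite size_tuple.
by exists (Tuple (introT eqP sp)); rewrite /= pp lp eqxx.
Qed.

Lemma dist_lt_card x y : dist e x y < #|T|.
Proof.
rewrite /dist -[X in _ < X](size_iota 0) -has_find; apply/hasP.
have /connectP[p pp ->] := graph_connect eG x y.
case/shortenP: pp => p' pp' up' _; exists (size p').
  by rewrite mem_iota /= add0n -/(size (x :: p')) -(card_uniqP up') max_card.
by apply/walkP; exists p'.
Qed.

Lemma dist_walk x y : walk_of_length e (dist e x y) x y.
Proof.
have lt_d := dist_lt_card x y.
have := @nth_find _ 0 (fun n => walk_of_length e n x y) (iota 0 #|T|).
rewrite has_find size_iota -/(dist e x y) nth_iota // add0n => /(_ lt_d).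
by [].
Qed.

Lemma dist_le n x y : walk_of_length e n x y -> dist e x y <= n.
Proof.
move=> wn; rewrite leqNgt; apply/negP => lt_n.
have := before_find 0 lt_n; rewrite nth_iota ?add0n ?wn //.
exact: ltn_trans lt_n (dist_lt_card x y).
Qed.

Lemma dist_eq0 x y : (dist e x y == 0) = (x == y).
Proof.
apply/eqP/eqP => [d0 | ->].
  by have := dist_walk x y; rewrite d0 => /walkP[[|a p] []].
by apply/eqP; rewrite -leqn0; apply: dist_le; apply/walkP; exists [::].
Qed.

Lemma distxx x : dist e x x = 0.
Proof. by apply/eqP; rewrite dist_eq0. Qed.

Lemma dist_sym x y : dist e x y = dist e y x.
Proof.
suff le u v : dist e u v <= dist e v u by apply/eqP; rewrite eqn_leq !le.
apply: dist_le; have /walkP[p [sp pp lp]] := dist_walk v u.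
apply/walkP; exists (rev (belast v p)); split.
- by rewrite size_rev size_belast.
- rewrite -lp rev_path; apply: sub_path pp => a b /=.
  by rewrite (graph_sym eG).
- case: p {sp pp} lp => [|a p] //= _.
  by rewrite rev_cons last_rcons.
Qed.

Lemma dist_edge x y z : e y z -> dist e x z <= (dist e x y).+1.
Proof.
move=> eyz; apply: dist_le.
have /walkP[p [sp pp lp]] := dist_walk x y.
by apply/walkP; exists (rcons p z); rewrite size_rcons sp rcons_path pp lp last_rcons.
Qed.

Lemma dist_pred x y n : dist e x y = n.+1 -> exists2 z, e z y & dist e x z = n.
Proof.
move=> dn; have := dist_walk x y; rewrite dn => /walkP[p []].
case/lastP: p => [|p z] //; rewrite size_rcons last_rcons rcons_path.
move=> [sp] /andP[pp ez] zy; subst z; exists (last x p) => //.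
apply/eqP; rewrite eqn_leq; apply/andP; split.
  by apply: dist_le; apply/walkP; exists p.
by have := dist_edge x ez; rewrite dn.
Qed.

Lemma dist_eq1 x y : (dist e x y == 1) = e x y.
Proof.
apply/eqP/idP => [/dist_pred[z ezy /eqP] | exy].
  by rewrite dist_eq0 => /eqP->.
apply/eqP; rewrite eqn_leq; apply/andP; split.
  by have := dist_edge x exy; rewrite distxx.
by rewrite lt0n dist_eq0; apply: contraTneq exy => ->; rewrite (graph_irr eG).
Qed.

Lemma edge_dist1 x y : e x y -> dist e x y = 1.
Proof. by rewrite -dist_eq1 => /eqP. Qed.

Lemma dist_common_nbr x y z : e x z -> e z y -> x != y -> ~~ e x y -> dist e x y = 2.
Proof.
move=> exz ezy; rewrite -dist_eq0 -dist_eq1.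
have := dist_edge x ezy; rewrite (edge_dist1 exz).
by case: (dist e x y) => [|[|[|]]].
Qed.

Lemma dist_le_diameter x y : dist e x y <= diameter e.
Proof.
apply: leq_trans (leq_bigmax x).
exact: (leq_bigmax (F := fun y => dist e x y)).
Qed.

Lemma diameter_attained : exists x y, dist e x y = diameter e.
Proof.
have T0 := graph_nonempty eG.
have [x Hx] := @bigop.eq_bigmax _ (fun x => \max_(y : T) dist e x y) T0.
have [y Hy] := @bigop.eq_bigmax _ (fun y => dist e x y) T0.
by exists x, y; rewrite /diameter Hx Hy.
Qed.

Lemma exists_dist n x y : n <= dist e x y -> exists z, dist e x z = n.
Proof.
move=> le_n; suff H m : forall y, dist e x y = n + m -> exists z, dist e x z = n.
  by apply: (H (dist e x y - n) y); rewrite subnKC.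
elim: m => [|m IH] w; first by rewrite addn0; exists w.
by rewrite addnS => /dist_pred[z _ /IH].
Qed.

End Metric.

(** * Eigenfunctions and the cosine matrix *)

Section Cosine.
Variables (R : realType) (T : finType) (e : rel T) (b c : nat -> nat).
Hypothesis drg : distance_regular e b c.
Let eG := drg_connected drg.
Let D := diameter e.
Local Open Scope ring_scope.
Local Notation d := (dist e).

Definition eigenfun (t : R) (h : T -> R) : Prop :=
  forall y, \sum_(z | e y z) h z = t * h y.

Definition sphere_sum (h : T -> R) (x : T) (i : nat) : R := \sum_(z | d x z == i) h z.

Lemma degree y : #|[set z | e y z]| = b 0.
Proof.
rewrite -(distxx eG y) -(drg_b drg y y); apply: eq_card => z.
by rewrite !inE distxx // dist_eq1 // andbb.
Qed.

Lemma nbr_dist x y z : e y z -> [|| d x z == (d x y).+1, d x z == d x y | (d x z).+1 == d x y].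
Proof.
move=> eyz; have := dist_edge eG x eyz; rewrite (graph_sym eG) in eyz.
by have := dist_edge eG x eyz; lia.
Qed.

Lemma card_same x y :
  #|[set z | e y z && (d x z == d x y)]| = (b 0 - b (d x y) - c (d x y))%N.
Proof.
rewrite -(drg_b drg) -(drg_c drg) -(degree y).
rewrite -(cardsID [set z | d x z == (d x y).+1] [set z | e y z]).
rewrite -(cardsID [set z | (d x z).+1 == d x y] ([set z | e y z] :\: _)).
set A := _ :&: _; set B := _ :&: _; set C := _ :\: _.
have -> : [set z | e y z && (d x z == (d x y).+1)] = A.
  by apply/setP => z; rewrite !inE.
have -> : [set z | e y z && ((d x z).+1 == d x y)] = B.
  by apply/setP => z; rewrite !inE; case: (e y z); rewrite ?andbF //=; lia.
suff -> : [set z | e y z && (d x z == d x y)] = C by lia.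
apply/setP => z; rewrite !inE; case eyz: (e y z); rewrite ?andbF //=.
by have := nbr_dist x eyz; lia.
Qed.

(** The contribution b_(i-1) s_(i-1) to the three-term recurrence below, which is
    absent for i = 0. *)
Definition prev_term (s : nat -> R) (i : nat) : R :=
  if i is j.+1 then (b j)%:R * s j else 0.

(** Sum the eigenvalue equation over the sphere of radius i and count, for each z,
    the neighbours of z on that sphere. *)
Lemma sphere_sum_rec t h x i : eigenfun t h ->
  t * sphere_sum h x i = (c i.+1)%:R * sphere_sum h x i.+1
    + (b 0 - b i - c i)%:R * sphere_sum h x i + prev_term (sphere_sum h x) i.
Proof.
move=> hE; rewrite /sphere_sum.
have -> : t * (\sum_(z | d x z == i) h z) = \sum_(w | d x w == i) \sum_(z | e w z) h z.
  by rewrite mulr_sumr; apply: eq_bigr => w _; rewrite hE.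
have -> : \sum_(w | d x w == i) \sum_(z | e w z) h z
   = \sum_z #|[set w | e z w && (d x w == i)]|%:R * h z.
  rewrite (exchange_big_dep predT) //=; apply: eq_bigr => z _.
  rewrite sumr_const mulr_natl; congr (_ *+ _); apply: eq_card => w.
  by rewrite !inE /= (graph_sym eG) andbC.
have prevE : prev_term (fun i => \sum_(z | d x z == i) h z) i =
   \sum_z (if (d x z).+1 == i then (b (d x z))%:R * h z else 0).
  case: i => [|i] /=; first by rewrite big1.
  rewrite mulr_sumr big_mkcond; apply: eq_bigr => z _; rewrite eqSS.
  by case: eqP => // ->.
rewrite prevE !mulr_sumr (big_mkcond (fun z => d x z == i.+1)).
rewrite (big_mkcond (fun z => d x z == i)) -!big_split /=.
apply: eq_bigr => z _.
case: (ltngtP (d x z) i) => dz.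
- rewrite (_ : (d x z == i.+1) = false); last by lia.
  rewrite !add0r; case: eqP => dz1.
    by rewrite -dz1 -(drg_b drg).
  rewrite (_ : [set w | _] = set0) ?cards0 ?mul0r //.
  apply/setP => w; rewrite !inE; apply/negP => /andP[ezw /eqP dw].
  by have := nbr_dist x ezw; lia.
- rewrite (_ : ((d x z).+1 == i) = false); last by lia.
  rewrite !addr0; case: eqP => dz1.
    rewrite -dz1 -(drg_c drg); congr (_%:R * _); apply: eq_card => w.
    by rewrite !inE dz1 eqSS.
  rewrite (_ : [set w | _] = set0) ?cards0 ?mul0r //.
  apply/setP => w; rewrite !inE; apply/negP => /andP[ezw /eqP dw].
  by have := nbr_dist x ezw; lia.
- rewrite (_ : (d x z == i.+1) = false); last by lia.
  rewrite (_ : ((d x z).+1 == i) = false); last by lia.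
  by rewrite add0r addr0 -dz card_same.
Qed.

Lemma c_gt0 i : (i < D)%N -> (0 < c i.+1)%N.
Proof.
move=> iD; have [x [y dxy]] := diameter_attained eG.
have [z dz] : exists z, d x z = i.+1 by apply: (exists_dist eG (y := y)); rewrite dxy.
rewrite -dz -(drg_c drg) dz; have [w ewz dw] := dist_pred eG dz.
by apply/card_gt0P; exists w; rewrite inE (graph_sym eG) ewz dw /=.
Qed.

Lemma b_gt0 i : (i < D)%N -> (0 < b i)%N.
Proof.
move=> iD; have [x [y dxy]] := diameter_attained eG.
have [z dz] : exists z, d x z = i.+1 by apply: (exists_dist eG (y := y)); rewrite dxy.
have [w ewz dw] := dist_pred eG dz.
by rewrite -dw -(drg_b drg); apply/card_gt0P; exists z; rewrite inE ewz dw dz /=.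
Qed.

Lemma sphere_sum0 h x : sphere_sum h x 0 = h x.
Proof.
rewrite /sphere_sum (eq_bigl (pred1 x)) ?big_pred1_eq // => z.
by rewrite /= dist_eq0 // eq_sym.
Qed.

Lemma sphere_sum_big h x i : (D < i)%N -> sphere_sum h x i = 0.
Proof.
move=> Di; rewrite /sphere_sum big1 // => z /eqP dz.
by have := dist_le_diameter e x z; rewrite dz leqNgt Di.
Qed.

(** The three-term recurrence determines the sphere sums of an eigenfunction from
    its value at the centre, because c_(i+1) is nonzero below the diameter.  So
    the ratio of a sphere sum to the central value depends neither on the
    centre nor on the eigenfunction; cross-multiplying allows central value 0. *)
Lemma sphere_sum_radial t g h x y i : eigenfun t g -> eigenfun t h ->
  sphere_sum h y i * g x = sphere_sum g x i * h y.
Proof.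
move=> gE hE; suff [] : sphere_sum h y i * g x = sphere_sum g x i * h y /\
  sphere_sum h y i.+1 * g x = sphere_sum g x i.+1 * h y by [].
have step j : sphere_sum h y j * g x = sphere_sum g x j * h y ->
    prev_term (sphere_sum h y) j * g x = prev_term (sphere_sum g x) j * h y ->
    sphere_sum h y j.+1 * g x = sphere_sum g x j.+1 * h y.
  move=> Ej Ep; case: (ltnP j D) => jD; last first.
    by rewrite !sphere_sum_big // !mul0r.
  have cj : (c j.+1)%:R != 0 :> R by rewrite pnatr_eq0 -lt0n c_gt0.
  apply: (mulfI cj); rewrite !mulrA.
  have := sphere_sum_rec y j hE; have := sphere_sum_rec x j gE.
  set A := _%:R * sphere_sum g x j.+1; set B := _%:R * sphere_sum h y j.+1.
  move=> E1 E2.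
  have -> : A = t * sphere_sum g x j - (b 0 - b j - c j)%:R * sphere_sum g x j
     - prev_term (sphere_sum g x) j by rewrite E1; ring.
  have -> : B = t * sphere_sum h y j - (b 0 - b j - c j)%:R * sphere_sum h y j
     - prev_term (sphere_sum h y) j by rewrite E2; ring.
  by rewrite !mulrBl Ep -!mulrA Ej.
elim: i => [|i [IH1 IH2]].
  have E0 : sphere_sum h y 0 * g x = sphere_sum g x 0 * h y.
    by rewrite !sphere_sum0 mulrC.
  by split=> //; apply: step => //=; rewrite !mul0r.
by split=> //; apply: step => //=; rewrite -!mulrA IH1.
Qed.

Definition sphere_size (x : T) (i : nat) : nat := #|[set z | d x z == i]|.

Lemma sphere_size_sum x i : (sphere_size x i)%:R = sphere_sum (fun=> 1) x i.
Proof. by rewrite /sphere_sum sumr_const; congr (_%:R); apply: eq_card => z; rewrite inE. Qed.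

Lemma eigenfun_const : eigenfun (b 0)%:R (fun=> 1).
Proof.
by move=> y; rewrite sumr_const mulr1 -(degree y); congr (_%:R); apply: eq_card => z; rewrite inE.
Qed.

(** Constant functions are eigenfunctions for the valency, so this is
    [sphere_sum_radial] for the constant 1. *)
Lemma sphere_size_const x y i : sphere_size x i = sphere_size y i.
Proof.
apply/eqP; rewrite -(eqr_nat R) !sphere_size_sum; apply/eqP.
by have := sphere_sum_radial x y i eigenfun_const eigenfun_const; rewrite !mulr1.
Qed.

Lemma sphere_size_gt0 x i : (i <= D)%N -> (0 < sphere_size x i)%N.
Proof.
have [x' [y dxy]] := diameter_attained eG; move=> iD.
rewrite (sphere_size_const x x').
have [|z dz] := @exists_dist _ _ eG i x' y; first by rewrite dxy.
by apply/card_gt0P; exists z; rewrite inE dz /=.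
Qed.

(** Both sides count the edges between the spheres of radius i and i + 1. *)
Lemma sphere_size_rec x i : (sphere_size x i * b i = sphere_size x i.+1 * c i.+1)%N.
Proof.
rewrite /sphere_size -!sum_nat_const.
transitivity (\sum_(w in [set z | d x z == i]) \sum_(z in [set z | d x z == i.+1]) (e w z : nat))%N.
  apply: eq_bigr => w; rewrite inE => /eqP dw; rewrite -dw -(drg_b drg) -sum1_card.
  rewrite big_mkcond [RHS]big_mkcond; apply: eq_bigr => z _; rewrite !inE.
  by case: (e w z); case: (d x z == _).
rewrite exchange_big; apply: eq_bigr => w; rewrite inE => /eqP dw.
rewrite -dw -(drg_c drg) -sum1_card big_mkcond [RHS]big_mkcond.
apply: eq_bigr => z _; rewrite !inE dw eqSS (graph_sym eG).
by case: (e w z); case: (d x z == _).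
Qed.

Lemma sum_nbr_radial (u : nat -> R) z y (i := d z y) :
  \sum_(w | e y w) u (d z w) =
    (b i)%:R * u i.+1 + (b 0 - b i - c i)%:R * u i + (c i)%:R * u i.-1.
Proof.
rewrite {1 2 4}/i -card_same -(drg_b drg) -(drg_c drg) -/i.
rewrite !mulr_natl -!sumr_const.
rewrite big_mkcond [in RHS]big_mkcond [X in _ + X + _]big_mkcond
  [X in _ + _ + X]big_mkcond -!big_split /=.
apply: eq_bigr => w _; rewrite !inE; case eyw: (e y w); rewrite /= ?addr0 //.
have := nbr_dist z eyw; rewrite -/i => /or3P[] /eqP dw.
- by rewrite dw eqxx gtn_eqF // gtn_eqF // !addr0.
- by rewrite dw eqxx ltn_eqF // gtn_eqF // addr0 add0r.
- by rewrite -dw eqxx ltn_eqF // ltn_eqF // !add0r.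
Qed.

(** Let u_i be the average of g over the sphere of radius i around x0, divided by
    g x0, and E the matrix with entries u_(d(y,z)).  Its rows are eigenfunctions,
    so by [sphere_sum_radial] the product E E is C E with C = sum_y u_(d(x0,y))^2
    positive; as E is symmetric, C E = E^T E is positive semidefinite. *)
Lemma cosine_matrix t g x0 : eigenfun t g -> g x0 != 0 ->
  exists u : nat -> R, [/\ u 0%N = 1,
    forall z, eigenfun t (fun y => u (d z y)) &
    forall f : T -> R, 0 <= \sum_y \sum_z f y * f z * u (d y z)].
Proof.
move=> gE g0; pose k i : R := (sphere_size x0 i)%:R.
pose u i := sphere_sum g x0 i / (k i * g x0).
have k0 i : (i <= D)%N -> k i != 0.
  by move=> iD; rewrite pnatr_eq0 -lt0n sphere_size_gt0.
have su i : (i <= D)%N -> sphere_sum g x0 i = k i * u i * g x0.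
  by move=> iD; rewrite /u; field; rewrite g0 k0.
have u0 : u 0%N = 1.
  have k1 : k 0%N = 1 by rewrite /k sphere_size_sum sphere_sum0.
  by rewrite /u sphere_sum0 k1 mul1r divff.
have uE z : eigenfun t (fun y => u (d z y)).
  move=> y; set i := d z y; have iD : (i <= D)%N := dist_le_diameter e z y.
  rewrite sum_nbr_radial -/i.
  have := sphere_sum_rec x0 i gE; rewrite su //.
  (* At i = D both sides vanish: b_D = 0 and the next sphere is empty. *)
  have -> : (c i.+1)%:R * sphere_sum g x0 i.+1 = k i * (b i)%:R * u i.+1 * g x0.
    case: (ltnP i D) => Di.
      rewrite su // /k -natrM sphere_size_rec natrM; ring.
    have -> : i = D by apply/eqP; rewrite eqn_leq iD.
    by rewrite sphere_sum_big // /D (drg_bD drg) !(mulr0, mul0r).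
  have -> : prev_term (sphere_sum g x0) i = k i * (c i)%:R * u i.-1 * g x0.
    case: i iD => [|i] iD /=; first by rewrite (drg_c0 drg) !(mulr0, mul0r).
    rewrite su; last exact: ltnW.
    rewrite /k -[_ * (c i.+1)%:R]natrM -sphere_size_rec natrM; ring.
  move=> E; have kg : k i * g x0 != 0 by rewrite mulf_neq0 ?k0.
  apply: (mulfI kg); transitivity (t * (k i * u i * g x0)); last by ring.
  by rewrite E; ring.
exists u; split=> // f.
pose C := \sum_y u (d x0 y) ^+ 2.
have C1 : 1 <= C.
  rewrite /C (bigD1 x0) //= distxx // u0 expr1n lerDl.
  by apply: sumr_ge0 => y _; rewrite sqr_ge0.
have conv z z' : \sum_y u (d z y) * u (d z' y) = C * u (d z z').
  have part (h : T -> R) x : \sum_y u (d x y) * h y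
     = \sum_(i < D.+1) u i * sphere_sum h x i.
    rewrite (partition_big (fun y => inord (d x y) : 'I_D.+1) predT) //=.
    apply: eq_bigr => i _; rewrite /sphere_sum mulr_sumr; apply: eq_big => y.
      rewrite -val_eqE /= inordK ?ltnS ?dist_le_diameter //.
    by move=> /eqP <-; rewrite inordK ?ltnS ?dist_le_diameter.
  rewrite part; have -> : C = \sum_(i < D.+1) u i * (k i * u i).
    rewrite /C; under eq_bigr do rewrite expr2.
    rewrite part; apply: eq_bigr => i _; congr (_ * _).
    rewrite /sphere_sum (eq_bigr (fun=> u i)) => [|y /eqP-> //].
    rewrite sumr_const mulr_natl; congr (_ *+ _); apply: eq_card => y.
    by rewrite inE.
  rewrite mulr_suml; apply: eq_bigr => i _; rewrite -[RHS]mulrA; congr (_ * _).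
  have iD : (i <= D)%N by rewrite -ltnS.
  apply: (mulIf g0); rewrite (sphere_sum_radial x0 z i gE (uE z')) su //.
  by rewrite (dist_sym eG z z'); ring.
suff : 0 <= C * \sum_y \sum_z f y * f z * u (d y z).
  by rewrite pmulr_rge0 //; apply: lt_le_trans C1.
have -> : C * (\sum_y \sum_z f y * f z * u (d y z)) = \sum_w (\sum_y f y * u (d y w)) ^+ 2.
  under [RHS]eq_bigr do rewrite expr2 mulr_suml.
  rewrite [RHS]exchange_big mulr_sumr; apply: eq_bigr => y _.
  under [RHS]eq_bigr do rewrite mulr_sumr.
  rewrite [RHS]exchange_big mulr_sumr; apply: eq_bigr => z _.
  rewrite mulrCA -conv mulr_sumr; apply: eq_bigr => w _.
  by ring.
by apply: sumr_ge0 => w _; rewrite sqr_ge0.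
Qed.

End Cosine.

(** * The least eigenvalue of the non-adjacency graph of a neighbourhood *)

Section LocalForm.
Variables (R : realType) (T : finType) (e : rel T) (b c : nat -> nat).
Hypothesis drg : distance_regular e b c.
Let eG := drg_connected drg.
Hypothesis D2 : 2 <= diameter e.
Local Open Scope ring_scope.
Local Notation d := (dist e).

(** The complement of the local graph of [x], as a relation on all vertices:
    vertices that are not neighbours of [x] are isolated. *)
Definition local_nonadj (x : T) : rel T :=
  fun u v => [&& e x u, e x v, u != v & ~~ e u v].

Lemma eigenfun_of_eigenvalue (t : R) : eigenvalue (adjacency_matrix e R) t ->
  exists g : T -> R, eigenfun e t g /\ exists x, g x != 0.
Proof.
case/eigenvalueP=> v vE /rV0Pn[i vi]; exists (fun y => v 0 (enum_rank y)).
split; last by exists (enum_val i); rewrite enum_valK.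
move=> y; have /rowP/(_ (enum_rank y)) := vE; rewrite !mxE => <-.
rewrite big_mkcond (reindex (@enum_val T T)) /=; last first.
  by apply: onW_bij; apply: enum_val_bij.
apply: eq_bigr => j _; rewrite !mxE enum_rankK enum_valK (graph_sym eG).
by case: (e _ y); rewrite ?mulr1 ?mulr0.
Qed.

Lemma c1_eq1 : c 1 = 1%N.
Proof.
have [x [y dxy]] := diameter_attained eG.
have [|z dz] := @exists_dist _ _ eG 1 x y; first by rewrite dxy; lia.
rewrite -dz -(drg_c drg) dz; apply/eqP/cards1P; exists x.
apply/setP => w; rewrite !inE eqSS (dist_eq0 eG) eq_sym.
by case: eqP => [->|]; rewrite ?andbF // andbT (graph_sym eG) -(dist_eq1 eG) dz.
Qed.

Lemma sum_split_nbr x (h : T -> R) (F : T -> T -> R) :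
    (forall y, ~~ e x y -> h y = 0) ->
  \sum_y \sum_z h y * h z * F y z = \sum_y h y ^+ 2 * F y y
    + \sum_y \sum_(z | e y z) h y * h z * F y z
    + \sum_y \sum_(z | local_nonadj x y z) h y * h z * F y z.
Proof.
move=> h0; rewrite -!big_split; apply: eq_bigr => y _ /=.
rewrite (bigD1 y) //= expr2 -addrA; congr (_ + _).
rewrite [in RHS]big_mkcond [X in _ + X]big_mkcond -big_split big_mkcond /=.
apply: eq_bigr => z _; rewrite /local_nonadj eq_sym.
have [->|yz] := eqVneq y z; first by rewrite (graph_irr eG) !andbF addr0.
case exy: (e x y); last by rewrite h0 ?exy // !mul0r /= !if_same addr0.
case exz: (e x z); last by rewrite (h0 z) ?exz // !(mulr0, mul0r) /= !if_same addr0.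
by case: (e y z); rewrite /= ?addr0 ?add0r.
Qed.

(** Evaluate the cosine matrix on f restricted to the neighbours of x, extended by
    s at x.  With F the sum of f there, the choice s = - u_1 F minimises the terms
    in s and F, which then contribute F^2 (u_1 - u_1^2) <= 0.  What remains is
    (1 - u_1) |f|^2 + (u_2 - u_1) G, where G is the form of the non-adjacency
    graph, and b_1 (u_2 - u_1) = (- t - 1) (1 - u_1). *)
Lemma local_form (alpha t : R) x : eigenvalue (adjacency_matrix e R) t ->
    0 < alpha -> t <= -1 - (b 1%N)%:R / alpha -> forall f : T -> R,
  0 <= alpha * (\sum_v f v ^+ 2) + \sum_u \sum_(v | local_nonadj x u v) f u * f v.
Proof.
move=> ev a0 tle f; have [g [gE [x0 g0]]] := eigenfun_of_eigenvalue ev.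
have [u [u0 uE pos]] := cosine_matrix drg gE g0.
have D1 : (1 < diameter e)%N by [].
have b1 : 0 < (b 1%N)%:R :> R by rewrite ltr0n (b_gt0 drg).
have k0 : 0 < (b 0%N)%:R :> R by rewrite ltr0n (b_gt0 drg) // ltnW.
have E1 : (b 0%N)%:R * u 1%N = t.
  have := uE x x; rewrite distxx // u0 mulr1 => <-.
  rewrite (eq_bigr (fun=> u 1%N)) => [|z exz]; last by rewrite (edge_dist1 eG exz).
  rewrite sumr_const -(degree drg x) mulr_natl; congr (_ *+ _).
  by apply: eq_card => z; rewrite inE.
have k1 : (b 0%N >= b 1%N + 1)%N.
  have [y [z dyz]] := diameter_attained eG.
  have [|w dw] := @exists_dist _ _ eG 1 y z; first by rewrite dyz; lia.
  rewrite -(degree drg w) -(cardsID [set z | d y z == (d y w).+1] [set z | e w z]).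
  have cb := drg_b drg y w; have cc := drg_c drg y w; rewrite dw in cb cc.
  apply: leq_add; first by rewrite -cb dw; apply: subset_leq_card; apply/subsetP => v; rewrite !inE.
  rewrite -[X in (X <= _)%N]c1_eq1 -cc dw; apply: subset_leq_card; apply/subsetP => v; rewrite !inE.
  by case: (e w v) => //=; lia.
have t1 : 0 < - t - 1 by have := divr_gt0 b1 a0; lra.
have bt : (b 1%N)%:R <= alpha * (- t - 1).
  rewrite mulrC -ler_pdivrMr //; lra.
have E2 : (b 1%N)%:R * (u 2 - u 1%N) = (- t - 1) * (1 - u 1%N).
  have [y [z dyz]] := diameter_attained eG.
  have [|w dw] := @exists_dist _ _ eG 1 y z; first by rewrite dyz; lia.
  have := uE y w; rewrite dw.
  rewrite (sum_nbr_radial drg) dw /=.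
  rewrite c1_eq1 u0 !natrB; [|lia|lia].
  move=> E; transitivity (t * u 1%N - t + u 1%N - 1); last by ring.
  by rewrite -E -E1; ring.
have u1 : u 1%N < 0 by rewrite -(pmulr_rlt0 _ k0) E1; lra.
pose h y := if e x y then f y else 0.
have hx y : ~~ e x y -> h y = 0 by rewrite /h => /negPf->.
have SG : \sum_y \sum_(z | local_nonadj x y z) f y * f z
        = \sum_y \sum_(z | local_nonadj x y z) h y * h z.
  by apply: eq_bigr => y _; apply: eq_bigr => z /and4P[ey ez _ _]; rewrite /h ey ez.
have Sh : \sum_y h y ^+ 2 <= \sum_y f y ^+ 2.
  apply: ler_sum => y _; rewrite /h; case: ifP => // _.
  by rewrite expr0n sqr_ge0.
rewrite SG; set G := \sum_y \sum_(z | _) _.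
suff main : 0 <= alpha * (\sum_y h y ^+ 2) + G.
  by apply: le_trans main _; rewrite lerD2r ler_pM2l.
set S := \sum_y h y ^+ 2 in Sh *.
pose F := \sum_y h y; pose M := \sum_y \sum_(z | e y z) h y * h z.
have FE : F ^+ 2 = S + M + G.
  transitivity (\sum_y \sum_z h y * h z * 1).
    rewrite expr2 mulr_suml; apply: eq_bigr => y _; rewrite mulr_sumr.
    by apply: eq_bigr => z _; rewrite mulr1.
  rewrite (sum_split_nbr (x := x)) //; congr (_ + _ + _).
  - by apply: eq_bigr => y _; rewrite mulr1.
  - by apply: eq_bigr => y _; apply: eq_bigr => z _; rewrite mulr1.
  - by apply: eq_bigr => y _; apply: eq_bigr => z _; rewrite mulr1.
pose s := - u 1%N * F.
have := pos (fun y => s * (y == x)%:R + h y).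
have delta (H : T -> R) : \sum_y (y == x)%:R * H y = H x.
  by rewrite (bigD1 x) //= eqxx mul1r big1 ?addr0 // => v /negPf->; rewrite mul0r.
have -> : \sum_y \sum_z (s * (y == x)%:R + h y) * (s * (z == x)%:R + h z) * u (d y z)
  = s ^+ 2 + 2 * s * (\sum_y h y * u (d x y)) + \sum_y \sum_z h y * h z * u (d y z).
  transitivity (\sum_y (s ^+ 2 * ((y == x)%:R * u (d y x))
     + s * ((y == x)%:R * (\sum_z h z * u (d y z)))
     + s * (h y * u (d y x))
     + \sum_z h y * h z * u (d y z))).
    apply: eq_bigr => y _.
    rewrite (eq_bigr (fun z => (z == x)%:R * (s ^+ 2 * (y == x)%:R * u (d y z)
       + s * h y * u (d y z)) + s * (y == x)%:R * (h z * u (d y z)) + h y * h z * u (d y z)));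
       last by move=> z _; ring.
    rewrite !big_split /= delta -mulr_sumr !mulrA; congr (_ + _); exact: addrAC.
  rewrite !big_split /=; set Q := \sum_y \sum_z h y * h z * _.
  rewrite -!mulr_sumr !delta distxx // u0.
  have -> : \sum_i h i * u (d i x) = \sum_i h i * u (d x i).
    by apply: eq_bigr => y _; rewrite (dist_sym eG).
  by ring.
have -> : \sum_y h y * u (d x y) = F * u 1%N.
  rewrite mulr_suml; apply: eq_bigr => y _.
  case exy: (e x y); last by rewrite hx ?exy ?mul0r.
  by rewrite (edge_dist1 eG exy).
rewrite (sum_split_nbr (x := x)) //.
have -> : \sum_y h y ^+ 2 * u (d y y) = S.
  by apply: eq_bigr => y _; rewrite distxx // u0 mulr1.
have -> : \sum_y \sum_(z | e y z) h y * h z * u (d y z) = M * u 1%N.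
  rewrite mulr_suml; apply: eq_bigr => y _; rewrite mulr_suml.
  by apply: eq_bigr => z eyz; rewrite (edge_dist1 eG eyz).
have -> : \sum_y \sum_(z | local_nonadj x y z) h y * h z * u (d y z) = G * u 2.
  rewrite mulr_suml; apply: eq_bigr => y _; rewrite mulr_suml.
  apply: eq_bigr => z /and4P[exy exz yz nyz].
  by rewrite (dist_common_nbr eG (z := x)) // (graph_sym eG).
have -> : M = F ^+ 2 - S - G by rewrite FE; ring.
move=> H; have H' : 0 <= (1 - u 1%N) * S + (u 2 - u 1%N) * G.
  have : 0 <= F ^+ 2 * (u 1%N ^+ 2 - u 1%N).
    by apply: mulr_ge0; [exact: sqr_ge0 | have := sqr_ge0 (u 1%N); lra].
  move: H; rewrite /s; lra.
have H2 : 0 <= (1 - u 1%N) * ((b 1%N)%:R * S + (- t - 1) * G).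
  have -> : (1 - u 1%N) * ((b 1%N)%:R * S + (- t - 1) * G) =
    (b 1%N)%:R * ((1 - u 1%N) * S) + (- t - 1) * (1 - u 1%N) * G by ring.
  rewrite -E2 -mulrA -mulrDr; apply: mulr_ge0 => //; exact: ltW.
rewrite pmulr_rge0 in H2; last by lra.
have S0 : 0 <= S by apply: sumr_ge0 => y _; rewrite sqr_ge0.
have H3 : 0 <= (- t - 1) * (alpha * S + G).
  apply: le_trans H2 _; rewrite mulrDr lerD2r mulrA [_ * alpha]mulrC.
  by rewrite ler_wpM2r.
by rewrite pmulr_rge0 in H3.
Qed.

End LocalForm.

(** * Ramsey and forbidden configurations *)

Section Ramsey.
Variables (T : finType) (g : rel T).
Hypothesis g_sym : symmetric g.
Hypothesis g_irr : irreflexive g.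

Definition nbrs (v : T) : {set T} := [set w | g v w].
Definition clique (C : {set T}) : Prop := {in C &, forall u v, u != v -> g u v}.
Definition independent (I : {set T}) : Prop := {in I &, forall u v, ~~ g u v}.

Lemma in_nbrs v w : (w \in nbrs v) = g v w.
Proof. by rewrite inE. Qed.

Lemma card_subset (A : {set T}) m : m <= #|A| -> exists2 B : {set T}, B \subset A & #|B| = m.
Proof.
move=> le_mA; exists [set x in take m (enum A)].
  by apply/subsetP => x; rewrite inE => /mem_take; rewrite mem_enum.
rewrite cardsE (card_uniqP _) ?take_uniq ?enum_uniq // size_take -cardE.
by case: ltngtP le_mA.
Qed.

Lemma clique_sub (B C : {set T}) : B \subset C -> clique C -> clique B.
Proof. by move=> /subsetP sBC cC u v /sBC uC /sBC vC; apply: cC. Qed.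

(** A vertex v splits the rest of S into neighbours and non-neighbours; one of
    the two parts has at least half of the size that S must have, and v is added
    to what is found there. *)
Lemma ramsey s m (S : {set T}) : 2 ^ (s + m) <= #|S| ->
  (exists I : {set T}, [/\ I \subset S, independent I & #|I| = s]) \/
  (exists C : {set T}, [/\ C \subset S, clique C & #|C| = m]).
Proof.
elim: s m S => [|s IHs] m S.
  by left; exists set0; rewrite sub0set cards0; split=> // u; rewrite inE.
elim: m S => [|m IHm] S.
  by right; exists set0; rewrite sub0set cards0; split=> // u; rewrite inE.
move=> leS; have S0 : 0 < #|S| by apply: leq_trans leS; rewrite expn_gt0.
have /card_gt0P[v vS] := S0.
pose A := S :&: nbrs v; pose B := (S :\: nbrs v) :\ v.
have vB : v \in S :\: nbrs v by rewrite !inE g_irr vS.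
have cAB : #|S| = #|A| + #|B|.+1.
  by rewrite -(cardsID (nbrs v) S) (cardsD1 v (S :\: _)) vB.
have : (2 ^ (s + m.+1) <= #|B|) || (2 ^ (s.+1 + m) <= #|A|).
  rewrite addSn expnS in leS; rewrite addSnnS.
  by case: leqP => //= ltB; lia.
case/orP=> [/IHs[] | /IHm[]] [X [sX pX cX]].
- left; exists (v |: X); have vX : v \notin X.
    by apply/negP => /(subsetP sX); rewrite !inE eqxx.
  split; last by rewrite cardsU1 vX cX.
    rewrite subUset sub1set vS; apply: subset_trans sX _.
    by apply/subsetP => u; rewrite !inE => /and3P[].
  have nv u : u \in X -> ~~ g v u.
    by move/(subsetP sX); rewrite !inE => /and3P[].
  move=> u w /setU1P[->|uX] /setU1P[->|wX]; rewrite ?g_irr ?nv //.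
    by rewrite g_sym nv.
  exact: pX.
- right; exists X; split=> //; apply: subset_trans sX _.
  by apply/subsetP => u; rewrite !inE => /and3P[].
- left; exists X; split=> //; apply: subset_trans sX _; exact: subsetIl.
- right; exists (v |: X); have vX : v \notin X.
    by apply/negP => /(subsetP sX); rewrite !inE g_irr andbF.
  split; last by rewrite cardsU1 vX cX.
    rewrite subUset sub1set vS; apply: subset_trans sX _; exact: subsetIl.
  have nv u : u \in X -> g v u by move/(subsetP sX); rewrite !inE => /andP[].
  move=> u w /setU1P[->|uX] /setU1P[->|wX] uw; first by rewrite eqxx in uw.
  + exact: nv.
  + by rewrite g_sym nv.
  + exact: pX.
Qed.

End Ramsey.

Section Forbidden.
Variables (T : finType) (g : rel T).
Hypothesis g_sym : symmetric g.
Hypothesis g_irr : irreflexive g.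
Local Open Scope ring_scope.
Local Notation N := (nbrs g).

(** The matrix p I + q A is positive semidefinite, so the least eigenvalue of the
    graph is at least - p / q; integral vectors suffice for this, and they let the
    test values below be computed. *)
Definition form_nonneg (p q : nat) : Prop := forall f : T -> int,
  0 <= p%:Z * (\sum_v f v ^+ 2) + q%:Z * (\sum_u \sum_(v | g u v) f u * f v).

Hypothesis Hform : form_nonneg 5 2.

(** The value 3 at [v0] is near the optimum for blocks of size 8: for a star with
    8 leaves the form with coefficients 5 and 2 is 85 - 96, and for a clique split
    by [v0] into 8 neighbours and 8 non-neighbours it is 125 - 128. *)
Definition split_test (v0 : T) (P Q : {set T}) (v : T) : int :=
  3 * (v == v0)%:R - (v \in P)%:R + (v \in Q)%:R.

Lemma sum_mem (A : {set T}) (F : T -> int) : \sum_v (v \in A)%:R * F v = \sum_(v in A) F v.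
Proof. by rewrite [RHS]big_mkcond; apply: eq_bigr => v _; case: (v \in A); rewrite ?mul1r ?mul0r. Qed.

Lemma sum_eq (a : T) (F : T -> int) : \sum_v (v == a)%:R * F v = F a.
Proof.
rewrite (bigD1 a) //= eqxx mul1r big1 ?addr0 // => v /negPf->.
by rewrite mul0r.
Qed.

Lemma split_test_sum v0 (P Q : {set T}) (F : T -> int) :
  \sum_v split_test v0 P Q v * F v = 3 * F v0 - \sum_(v in P) F v + \sum_(v in Q) F v.
Proof.
rewrite -!sum_mem -(sum_eq v0 F) mulr_sumr -sumrN -!big_split /=.
by apply: eq_bigr => v _; rewrite /split_test; ring.
Qed.

Lemma split_test_row v0 (P Q : {set T}) u :
  \sum_(v | g u v) split_test v0 P Q v = 3 * (g u v0)%:R - #|P :&: N u|%:Z + #|Q :&: N u|%:Z.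
Proof.
have -> : \sum_(v | g u v) split_test v0 P Q v = \sum_v split_test v0 P Q v * (g u v)%:R.
  by rewrite big_mkcond; apply: eq_bigr => v _; case: (g u v); rewrite ?mulr1 ?mulr0.
rewrite split_test_sum; have E (A : {set T}) : \sum_(v in A) (g u v)%:R = #|A :&: N u|%:Z :> int.
  rewrite -sum1_card -natr_sum natz; congr (Posz _).
  rewrite big_mkcond [RHS]big_mkcond; apply: eq_bigr => v _ /=.
  by rewrite !inE; case: (v \in A); case: (g u v).
by rewrite !E.
Qed.

Lemma split_test_form v0 (P Q : {set T}) :
  v0 \notin P -> v0 \notin Q -> [disjoint P & Q] ->
  0 <= 5 * (9 + #|P|%:Z + #|Q|%:Z)
       + 2 * (3 * (#|Q :&: N v0|%:Z - #|P :&: N v0|%:Z)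
       - \sum_(u in P) (3 * (g u v0)%:R - #|P :&: N u|%:Z + #|Q :&: N u|%:Z)
       + \sum_(u in Q) (3 * (g u v0)%:R - #|P :&: N u|%:Z + #|Q :&: N u|%:Z)).
Proof.
move=> vP vQ dPQ; have := Hform (split_test v0 P Q).
have -> : \sum_u \sum_(v | g u v) split_test v0 P Q u * split_test v0 P Q v
  = \sum_u split_test v0 P Q u * (\sum_(v | g u v) split_test v0 P Q v).
  by apply: eq_bigr => u _; rewrite mulr_sumr.
have -> : \sum_v split_test v0 P Q v ^+ 2 = \sum_v split_test v0 P Q v * split_test v0 P Q v by [].
have dis u : u \in P -> (u \in Q) = false by move/(disjointFr dPQ).
have dis' u : u \in Q -> (u \in P) = false by move/(disjointFl dPQ).
rewrite !split_test_sum.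
have card1 (A : {set T}) (c : int) : \sum_(v in A) c = #|A|%:Z * c.
  by rewrite sumr_const -mulr_natl natz.
have -> : \sum_(v in P) split_test v0 P Q v = #|P|%:Z * -1.
  rewrite -card1; apply: eq_bigr => v vinP; rewrite /split_test vinP dis //.
  by rewrite (negPf (memPn vP _ vinP)).
have -> : \sum_(v in Q) split_test v0 P Q v = #|Q|%:Z * 1.
  rewrite -card1; apply: eq_bigr => v vinQ; rewrite /split_test vinQ dis' //.
  by rewrite (negPf (memPn vQ _ vinQ)).
have -> : split_test v0 P Q v0 = 3 by rewrite /split_test eqxx (negPf vP) (negPf vQ).
have rows (A : {set T}) : \sum_(u in A) \sum_(v | g u v) split_test v0 P Q v =
  \sum_(u in A) (3 * (g u v0)%:R - #|P :&: N u|%:Z + #|Q :&: N u|%:Z).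
  by apply: eq_bigr => u _; rewrite split_test_row.
rewrite !rows split_test_row g_irr.
by set a := \sum_(i in P) _; set b := \sum_(i in Q) _; lia.
Qed.

Lemma no_induced_star8 v (I : {set T}) :
  I \subset N v -> independent g I -> #|I| = 8 -> False.
Proof.
move=> /subsetP sI indI cI.
have gv u : u \in I -> g v u by move/sI; rewrite inE.
have vI : v \notin I by apply/negP => /gv; rewrite g_irr.
have := @split_test_form v I set0 vI; rewrite inE => /(_ isT).
rewrite -setI_eq0 setI0 eqxx => /(_ isT).
rewrite big_set0 (eq_bigr (fun=> 3)); last first.
  move=> u uI; rewrite g_sym gv // set0I.
  have -> : I :&: N u = set0.
    by apply/setP => w; rewrite !inE; case wI: (w \in I); rewrite //= (negPf (indI _ _ _ _)).
  by rewrite cards0.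
have -> : I :&: N v = I by apply/setIidPl/subsetP.
by rewrite set0I sumr_const cards0 cI.
Qed.

Lemma clique_row (C : {set T}) u : clique g C -> u \in C -> C :&: N u = C :\ u.
Proof.
move=> cC uC; apply/setP => w; rewrite !inE andbC.
by case wC: (w \in C); rewrite ?andbF // !andbT; case: eqVneq => [->|wu]; rewrite ?g_irr // cC // eq_sym.
Qed.

(** On an 8 + 8 clique the vector with values -1 and 1 sums to 0, so it costs
    little, while it is strongly correlated with v. *)
Lemma clique_split v (P Q : {set T}) :
  clique g (P :|: Q) -> [disjoint P & Q] -> P \subset N v ->
  v \notin Q -> [disjoint Q & N v] ->  #|P| = 8 -> #|Q| = 8 -> False.
Proof.
move=> cPQ dPQ /subsetP sP vQ dQ cP cQ.
have gv u : u \in P -> g v u by move/sP; rewrite inE.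
have vP : v \notin P by apply/negP => /gv; rewrite g_irr.
have ngv u : u \in Q -> g u v = false.
  by move/(disjointFr dQ); rewrite inE g_sym.
have := @split_test_form v P Q vP vQ dPQ.
have dis u : u \in P -> (u \in Q) = false by move/(disjointFr dPQ).
have dis' u : u \in Q -> (u \in P) = false by move/(disjointFl dPQ).
have cl1 u : u \in P -> #|P :&: N u| = 7 /\ Q :&: N u = Q.
  move=> uP; rewrite (clique_row (clique_sub (subsetUl P Q) cPQ) uP).
  split; first by have := cardsD1 u P; rewrite uP cP => -[].
  apply/setIidPl/subsetP => w wQ; rewrite inE cPQ ?inE ?uP ?wQ ?orbT //.
  by apply: contraTneq uP => ->; rewrite dis'.
have cl2 u : u \in Q -> #|Q :&: N u| = 7 /\ P :&: N u = P.
  move=> uQ; rewrite (clique_row (clique_sub (subsetUr P Q) cPQ) uQ).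
  split; first by have := cardsD1 u Q; rewrite uQ cQ => -[].
  apply/setIidPl/subsetP => w wP; rewrite inE cPQ ?inE ?uQ ?wP ?orbT //.
  by apply: contraTneq uQ => ->; rewrite dis.
rewrite (eq_bigr (fun=> 4)); last first.
  by move=> u uP; have [-> ->] := cl1 u uP; rewrite g_sym gv // cQ.
have -> : \sum_(u in Q) (3 * (g u v)%:R - #|P :&: N u|%:Z + #|Q :&: N u|%:Z)
  = \sum_(u in Q) -1.
  apply: eq_bigr => u uQ; have [-> ->] := cl2 u uQ; rewrite ngv // cP; lia.
have -> : P :&: N v = P by apply/setIidPl/subsetP.
rewrite (disjoint_setI0 dQ) cards0 !sumr_const cP cQ.
by [].
Qed.

End Forbidden.

(** * Clusters in dense regular graphs with bounded least eigenvalue *)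

Section Clusters.
Variables (T : finType) (g : rel T).
Hypothesis g_sym : symmetric g.
Hypothesis g_irr : irreflexive g.
Hypothesis Hform : form_nonneg g 5 2.
Local Notation N := (nbrs g).

Implicit Types C K P Q S : {set T}.

Definition cluster (C : {set T}) : {set T} := [set v | #|C :\: N v| < 8].

Lemma clique_in_nbrs v (S : {set T}) m : S \subset N v -> 2 ^ (8 + m) <= #|S| ->
  exists C : {set T}, [/\ C \subset S, clique g C & #|C| = m].
Proof.
move=> sS /(ramsey g_sym g_irr)[[I [sI iI cI]]|//].
by case: (no_induced_star8 g_sym g_irr Hform (subset_trans sI sS) iI cI).
Qed.

Lemma card_bigcup_le (K : {set T}) (F : T -> {set T}) m :
  (forall c, c \in K -> #|F c| <= m) -> #|\bigcup_(c in K) F c| <= #|K| * m.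
Proof.
move=> Fm; rewrite -sum_nat_const.
apply: (@leq_trans (\sum_(c in K) #|F c|)); last exact: leq_sum.
elim/big_rec2: _ => [|c k A _ le_kA]; first by rewrite cards0.
by apply: leq_trans (leq_card_setU _ _) _; rewrite leq_add2l.
Qed.

Lemma clique_sub_cluster C : clique g C -> C \subset cluster C.
Proof.
move=> cC; apply/subsetP => v vC; rewrite inE.
suff : C :\: N v \subset [set v] by move/subset_leq_card; rewrite cards1; lia.
apply/subsetP => w; rewrite !inE => /andP[ngw wC]; apply/eqP; apply: contraNeq ngw.
by move=> wv; rewrite cC // eq_sym.
Qed.

(** If v misses 8 vertices of C then by [clique_split] it has fewer than 8
    neighbours there: there is nothing between the two extremes. *)
Lemma card_clique_outside C v : clique g C -> v \notin cluster C -> #|C :&: N v| < 8.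
Proof.
move=> cC vQ; rewrite ltnNge; apply/negP => /card_subset[P sP cP].
move: (vQ); rewrite inE -leqNgt => /card_subset[Q sQ cQ].
apply: (clique_split g_sym g_irr Hform (v := v) (P := P) (Q := Q)) => //.
- apply: clique_sub cC; rewrite subUset (subset_trans sP (subsetIl _ _)).
  exact: subset_trans sQ (subsetDl _ _).
- rewrite -setI_eq0; apply/eqP/setP => w; rewrite in_set0; apply/negP.
  case/setIP => /(subsetP sP)/setIP[_ wN] /(subsetP sQ)/setDP[_].
  by rewrite wN.
- exact: subset_trans sP (subsetIr _ _).
- apply: contra vQ => /(subsetP sQ)/setDP[vC _].
  exact: (subsetP (clique_sub_cluster cC)).
- rewrite -setI_eq0; apply/eqP/setP => w; rewrite in_set0; apply/negP.
  by case/setIP => /(subsetP sQ)/setDP[_ /negP].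
Qed.

(** Each member of K misses at most 7 vertices of C, so at most 56 vertices of C1
    are lost. *)
Lemma joined_subclique C (C1 : {set T}) K : K \subset cluster C -> #|K| = 8 -> C1 \subset C ->
    64 <= #|C1| ->
  exists P : {set T}, [/\ P \subset C1, #|P| = 8 &
    forall c p, c \in K -> p \in P -> g c p].
Proof.
move=> sK cK sC1 cC1.
have le_bad : #|\bigcup_(c in K) (C :\: N c)| <= 56.
  apply: leq_trans (card_bigcup_le (m := 7) _) _; last by rewrite cK.
  by move=> c /(subsetP sK); rewrite inE.
have : 8 <= #|C1 :\: \bigcup_(c in K) (C :\: N c)|.
  by have := cardsID (\bigcup_(c in K) (C :\: N c)) C1;
     have := subset_leq_card (subsetIr C1 (\bigcup_(c in K) (C :\: N c))); lia.
case/card_subset=> P sP cP; exists P; split=> //.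
  exact: subset_trans sP (subsetDl _ _).
move=> c p cinK /(subsetP sP)/setDP[pC1 pbad]; apply: contraNT pbad => ngcp.
by apply/bigcupP; exists c; rewrite // !inE ngcp (subsetP sC1).
Qed.

Lemma cliqueU (P K : {set T}) : clique g P -> clique g K ->
  (forall c p, c \in K -> p \in P -> g c p) -> clique g (P :|: K).
Proof.
move=> cP cK gKP u w /setUP[uP|uK] /setUP[wP|wK] uw.
- exact: cP.
- by rewrite g_sym gKP.
- exact: gKP.
- exact: cK.
Qed.

(** Eight independent members of the cluster would form an induced star with a
    common neighbour in C. *)
Lemma cluster_has_clique8 C (S : {set T}) : 64 <= #|C| -> S \subset cluster C ->
    2 ^ (8 + 8) <= #|S| ->
  exists K : {set T}, [/\ K \subset S, clique g K & #|K| = 8].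
Proof.
move=> cC sS /(ramsey g_sym g_irr)[[I [sI iI cI]]|//].
have [P [_ cP gIP]] := joined_subclique (subset_trans sI sS) cI (subxx C) cC.
have /card_gt0P[p pP] : 0 < #|P| by rewrite cP.
case: (no_induced_star8 g_sym g_irr Hform (v := p) (I := I)) => //.
by apply/subsetP => c cI'; rewrite inE g_sym gIP.
Qed.

Lemma joined_disjoint (P K : {set T}) :
  (forall c p, c \in K -> p \in P -> g c p) -> [disjoint P & K].
Proof.
move=> gKP; rewrite -setI_eq0; apply/eqP/setP => w; rewrite in_set0; apply/negP.
by case/setIP => wP wK; have := gKP _ _ wK wP; rewrite g_irr.
Qed.

(** Otherwise the cluster contains an 8-clique K of non-neighbours of v.  Since v
    has almost all of C as neighbours, 8 of these are joined to all of K, and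
    [clique_split] applies.  The size 71 is 8 + 7 + 56: at most 7 vertices of C
    are lost to v and 56 to K. *)
Lemma cluster_missing C v : clique g C -> 71 <= #|C| -> v \in cluster C ->
  #|(cluster C :\: N v) :\ v| < 2 ^ (8 + 8).
Proof.
move=> cC cardC vQ; rewrite ltnNge; apply/negP => big.
have C64 : 64 <= #|C| by lia.
have sS : (cluster C :\: N v) :\ v \subset cluster C.
  by rewrite (subset_trans (subsetDl _ _) (subsetDl _ _)).
have [K [sK cK cardK]] := cluster_has_clique8 C64 sS big.
have C1 : 64 <= #|C :&: N v|.
  by move: vQ; rewrite inE; have := cardsID (N v) C; lia.
have [P [sP cP gKP]] :=
  joined_subclique (subset_trans sK sS) cardK (subsetIl C (N v)) C1.
have cP' : clique g P by apply: clique_sub cC; apply: subset_trans sP (subsetIl _ _).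
apply: (clique_split g_sym g_irr Hform (v := v) (P := P) (Q := K)) => //.
- exact: cliqueU.
- exact: joined_disjoint.
- exact: subset_trans sP (subsetIr _ _).
- by apply/negP => /(subsetP sK); rewrite !inE eqxx.
- rewrite -setI_eq0; apply/eqP/setP => w; rewrite in_set0; apply/negP.
  case/setIP => /(subsetP sK); rewrite 3!inE => /and3P[_ /negP]; by [].
Qed.

(** As for [cluster_missing], with the two halves of the clique exchanged. *)
Lemma cluster_outside C v : clique g C -> 71 <= #|C| -> v \notin cluster C ->
  #|cluster C :&: N v| < 2 ^ (8 + 8).
Proof.
move=> cC cardC vQ; rewrite ltnNge; apply/negP => big.
have C64 : 64 <= #|C| by lia.
have sS := subsetIl (cluster C) (N v).
have [K [sK cK cardK]] := cluster_has_clique8 C64 sS big.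
have C1 : 64 <= #|C :\: N v|.
  by have := card_clique_outside cC vQ; have := cardsID (N v) C; lia.
have [P [sP cP gKP]] :=
  joined_subclique (subset_trans sK sS) cardK (subsetDl C (N v)) C1.
have sPC : P \subset C := subset_trans sP (subsetDl _ _).
apply: (clique_split g_sym g_irr Hform (v := v) (P := K) (Q := P)) => //.
- rewrite setUC; apply: cliqueU => //; exact: clique_sub cC.
- by rewrite disjoint_sym joined_disjoint.
- exact: subset_trans sK (subsetIr _ _).
- apply: contra vQ => /(subsetP sPC).
  exact: (subsetP (clique_sub_cluster cC)).
- rewrite -setI_eq0; apply/eqP/setP => w; rewrite in_set0; apply/negP.
  by case/setIP => /(subsetP sP)/setDP[_ /negP].
Qed.

Variables (X : {set T}) (d : nat).
Hypothesis gX : forall u v, g u v -> u \in X.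
Hypothesis deg : forall u, u \in X -> #|N u| = d.
Hypothesis cardX : #|X| <= 3 * d + 3.

(** Let q be the size of the cluster.  Each of its vertices sends at least d - q
    edges out of it, and each outside vertex receives at most r of them, so
    q (d - q) <= r (3 d + 3): hence q is either at most about 6 r or at least
    about d - 6 r, and the first is excluded by the size of C. *)
Lemma cluster_large r C : 2 ^ (8 + 8) < r -> clique g C -> 6 * r + 71 <= #|C| ->
  d < #|cluster C| + (6 * r + 71).
Proof.
move=> hr cC cardC; set Q := cluster C.
have C71 : 71 <= #|C| by lia.
have sQX : Q \subset X.
  apply/subsetP => v; rewrite inE => vQ.
  have : 0 < #|C :&: N v| by have := cardsID (N v) C; lia.
  by case/card_gt0P=> w /setIP[_]; rewrite inE => /gX.
have lQ : 6 * r + 71 <= #|Q|.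
  exact: leq_trans cardC (subset_leq_card (clique_sub_cluster cC)).
rewrite ltnNge; apply/negP => small.
(* Double counting of the edges between the cluster and its complement. *)
have edges : \sum_(v in Q) #|N v :\: Q| = \sum_(u in X :\: Q) #|Q :&: N u|.
  transitivity (\sum_(v in Q) \sum_(u in X :\: Q) (g v u : nat)).
    apply: eq_bigr => v vQ; rewrite -sum1_card big_mkcond [RHS]big_mkcond.
    apply: eq_bigr => u _; rewrite !inE andbC; case gvu: (g v u).
      rewrite g_sym in gvu; rewrite (gX gvu) andbT; by case: ifP.
    by case: ifP.
  rewrite exchange_big; apply: eq_bigr => u _.
  rewrite -sum1_card big_mkcond [RHS]big_mkcond; apply: eq_bigr => v _.
  by rewrite !inE g_sym; case: ifP => //=; case: (g u v).
have lo : #|Q| * (d - #|Q|) <= \sum_(v in Q) #|N v :\: Q|.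
  rewrite -sum_nat_const; apply: leq_sum => v vQ.
  have := cardsID Q (N v); rewrite (deg (subsetP sQX v vQ)).
  by have := subset_leq_card (subsetIr (N v) Q); lia.
have hi : \sum_(u in X :\: Q) #|Q :&: N u| <= #|X :\: Q| * r.
  rewrite -sum_nat_const; apply: leq_sum => u /setDP[_ uQ].
  by have := cluster_outside cC C71 uQ; rewrite -/Q; lia.
have XQ : #|X :\: Q| <= 3 * d + 3 by have := cardsD X Q; lia.
have : #|Q| * (d - #|Q|) <= (3 * d + 3) * r.
  by rewrite (leq_trans lo) // edges (leq_trans hi) // leq_mul2r XQ orbT.
move: small lQ; set q := #|Q|; set L := 6 * r + 71 => small lQ.
pose s := d - q; have ds : d = q + s by rewrite subnKC //; lia.
rewrite -/s => h.
(* If both q and s are at least L then 2 q s >= L (q + s) = L d. *)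
have Ls : L <= s by lia.
have : 2 * (q * s) >= L * (q + s).
  rewrite mulnDr mul2n -addnn leq_add //; last by rewrite leq_mul2r lQ orbT.
  by rewrite mulnC leq_mul2l Ls orbT.
rewrite -ds; rewrite /L; nia.
Qed.

(** The cluster of v is that of a large clique among its neighbours: it contains v,
    and both it and the neighbourhood of v have size about d, each vertex of the
    cluster missing at most r others. *)
Lemma local_clusters r v : 2 ^ (8 + 8) < r -> 2 ^ (8 + (6 * r + 71)) <= d ->
    v \in X ->
  exists Q : {set T}, [/\ v \in Q, #|N v :\: Q| <= 8 * r + 71,
    #|Q :\: N v| <= r,
    forall w, w \in Q -> d <= #|N w :&: N v| + (8 * r + 71) &
    forall w, w \notin Q -> #|N w :&: Q| <= r /\ #|N w :&: N v| <= 8 * r + 71].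
Proof.
move=> hr hd vX.
have [|C [sC cC cardC]] := clique_in_nbrs (subxx (N v)) (m := 6 * r + 71).
  by rewrite deg.
have cardC' : 6 * r + 71 <= #|C| by rewrite cardC.
have C71 : 71 <= #|C| by lia.
have dQ := cluster_large hr cC cardC'.
have vQ : v \in cluster C.
  by rewrite inE; have /eqP-> : C :\: N v == set0; rewrite ?cards0 ?setD_eq0.
move: dQ; set Q := cluster C => dQ.
have miss w : w \in Q -> #|Q :\: N w| <= r.
  move=> wQ; have := cluster_missing cC C71 wQ; rewrite -/Q.
  by rewrite (cardsD1 w (Q :\: N w)); case: (w \in _) => /=; lia.
have NvQ : #|N v :\: Q| <= 7 * r + 71.
  have := miss v vQ; have := cardsID Q (N v); rewrite deg // setIC.
  by have := cardsID (N v) Q; lia.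
exists Q; split=> //.
- by lia.
- exact: miss.
- move=> w wQ; have := miss w wQ; have := miss v vQ.
  have : #|Q| <= #|N w :&: N v| + #|(Q :\: N w) :|: (Q :\: N v)|.
    apply: leq_trans (leq_card_setU _ _); apply: subset_leq_card.
    by apply/subsetP => u uQ; rewrite !(in_setU, in_setI, in_setD, in_nbrs) uQ; case: (g w u); case: (g v u).
  by have := (leq_card_setU (Q :\: N w) (Q :\: N v)).1; lia.
- move=> w wQ; have wr : #|N w :&: Q| <= r.
    by have := cluster_outside cC C71 wQ; rewrite -/Q setIC; lia.
  split=> //.
  have : #|N w :&: N v| <= #|N w :&: Q| + #|N v :\: Q|.
    apply: leq_trans (leq_card_setU _ _); apply: subset_leq_card.
    by apply/subsetP => u; rewrite !(in_setU, in_setI, in_setD, in_nbrs); case: (u \in Q); case: (g w u); case: (g v u).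
  lia.
Qed.

End Clusters.

(** * Neighbourhoods with few edges *)

Section LocalGraph.
Variables (T : finType) (e : rel T) (b c : nat -> nat).
Hypothesis drg : distance_regular e b c.
Let eG := drg_connected drg.
Local Notation d := (dist e).
Local Notation k := (b 0).
Local Notation N := (fun x => nbrs (local_nonadj e x)).

Lemma local_nonadj_sym x : symmetric (local_nonadj e x).
Proof. by move=> u v; rewrite /local_nonadj (graph_sym eG u) eq_sym andbCA. Qed.

Lemma local_nonadj_irr x : irreflexive (local_nonadj e x).
Proof. by move=> u; rewrite /local_nonadj eqxx !andbF. Qed.

Lemma card_nbrs x : #|nbrs e x| = k.
Proof. by rewrite -(degree drg x). Qed.

Lemma card_local_nonadj x v : e x v -> #|N x v| = b 1.
Proof.
move=> exv; have evx : e v x by rewrite (graph_sym eG).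
rewrite -(edge_dist1 eG evx) -(drg_b drg); apply: eq_card => w.
rewrite !inE /local_nonadj exv (edge_dist1 eG evx) /=; case exw: (e x w) => //=.
apply/andP/eqP => [[vw nvw]|dvw]; first exact: (dist_common_nbr eG evx).
by rewrite -(dist_eq0 eG) -(dist_eq1 eG) dvw.
Qed.

Definition triangles x u w : {set T} := nbrs e x :&: (nbrs e u :&: nbrs e w).

(** Inclusion and exclusion for the two neighbourhoods in the non-adjacency graph,
    of size b_1 each; the bounds differ by 2 because u and w may or may not lie in
    their union. *)
Lemma triangles_card x u w : e x u -> e x w ->
  k + #|N x u :&: N x w| <= #|triangles x u w| + 2 * b 1 + 2 /\
  #|triangles x u w| + 2 * b 1 <= k + #|N x u :&: N x w|.
Proof.
move=> exu exw.
have H := cardsUI (N x u) (N x w).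
rewrite !card_local_nonadj // in H.
have sub1 : nbrs e x \subset triangles x u w :|: ((N x u :|: N x w) :|: [set u; w]).
  apply/subsetP => z; rewrite !inE /local_nonadj exu exw => -> /=.
  by rewrite (eq_sym z u) (eq_sym z w); case: (u == z); case: (w == z); case: (e u z); case: (e w z).
have sub2 : triangles x u w :|: (N x u :|: N x w) \subset nbrs e x.
  apply/subsetP => z; rewrite !inE /local_nonadj.
  by case: (e x z); rewrite ?andbF.
have dis : [disjoint triangles x u w & N x u :|: N x w].
  rewrite -setI_eq0; apply/eqP/setP => z; rewrite !inE /local_nonadj.
  by case: (e x z); case: (e u z); case: (e w z); rewrite /= ?andbF ?andbT ?orbF ?andbF.
have := subset_leq_card sub1; have := subset_leq_card sub2.
rewrite card_nbrs cardsU (disjoint_setI0 dis) cards0 subn0.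
have := (leq_card_setU (triangles x u w) ((N x u :|: N x w) :|: [set u; w])).1.
have := (leq_card_setU (N x u :|: N x w) [set u; w]).1.
have : #|[set u; w]| <= 2 by rewrite cards2; case: (u != w).
move=> *; split; lia.
Qed.

Lemma common_nbrs_card u w : d u w = 2 -> #|nbrs e u :&: nbrs e w| = c 2.
Proof.
move=> duw; rewrite -duw -(drg_c drg); apply: eq_card => z.
by rewrite !inE duw eqSS (dist_eq1 eG) andbC.
Qed.

Definition two_path x u u1 u2 : Prop :=
  [/\ e x u, e x u1 && e x u2, e u u1, e u u2 & u1 != u2].

(** The local graph of x has valency a_1 < B, so fewer than k vertices are within
    distance 3 of u; any vertex v further away serves as the middle of the second
    path. *)
Lemma far_two_paths (B : nat) x :
    b 1 + 3 <= k -> k <= b 1 + B -> B.+1 ^ 3 < k ->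
  exists u u1 u2 v v1 v2, [/\ two_path x u u1 u2, two_path x v v1 v2 &
    {in [:: u; u1; u2] & [:: v; v1; v2], forall y z, y != z /\ ~~ e y z}].
Proof.
move=> a1 hB hk.
pose A u := nbrs e x :&: nbrs e u.
have cardA u : e x u -> #|A u| + b 1 + 1 = k.
  move=> exu; rewrite -(card_nbrs x) -(card_local_nonadj exu).
  rewrite (cardsD1 u (nbrs e x)) inE exu.
  suff -> : nbrs e x :\ u = A u :|: N x u.
    rewrite cardsU; suff -> : A u :&: N x u = set0 by rewrite cards0; lia.
    by apply/setP => w; rewrite !inE /local_nonadj; case: (e u w); rewrite ?andbF.
  apply/setP => w; rewrite !inE /local_nonadj exu (eq_sym u); case: (e x w); rewrite ?andbF //=.
  case: eqP => [->|]; first by rewrite (graph_irr eG).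
  by case: (e u w).
pose cl (X : {set T}) := X :|: \bigcup_(v in X) A v.
have cl_card (X : {set T}) : X \subset nbrs e x ->
   cl X \subset nbrs e x /\ #|cl X| <= #|X| * B.+1.
  move=> sX; split.
    rewrite subUset sX; apply/bigcupsP => v _; exact: subsetIl.
  apply: leq_trans (leq_card_setU _ _) _; rewrite mulnS leq_add2l.
  apply: card_bigcup_le => v /(subsetP sX); rewrite inE => /cardA; lia.
have cl_adj (X : {set T}) v w : v \in X -> e x w -> e v w -> w \in cl X.
  by move=> vX exw evw; apply/setUP; right; apply/bigcupP; exists v; rewrite ?inE ?exw.
have cl_in (X : {set T}) v : v \in X -> v \in cl X by move=> vX; rewrite inE vX.
have path u : e x u -> exists u1 u2, two_path x u u1 u2.
  move=> exu; have /card_subset[C sC /eqP/cards2P[u1 [u2 [u12 CE]]]] : 2 <= #|A u| by have := cardA u exu; lia.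
  have u1C : u1 \in A u by rewrite (subsetP sC) // CE !inE eqxx.
  have u2C : u2 \in A u by rewrite (subsetP sC) // CE !inE eqxx orbT.
  move: u1C u2C; rewrite !inE => /andP[? ?] /andP[? ?].
  by exists u1, u2; split=> //; apply/andP.
have /card_gt0P[u] : 0 < #|nbrs e x| by rewrite card_nbrs; lia.
rewrite inE => exu; have [u1 [u2 pu]] := path u exu; have [_ /andP[exu1 exu2] uu1 uu2 _] := pu.
have s0 : [set u] \subset nbrs e x by rewrite sub1set inE.
have [s1 n1] := cl_card _ s0; have [s2 n2] := cl_card _ s1; have [s3 n3] := cl_card _ s2.
have /card_gt0P[v] : 0 < #|nbrs e x :\: cl (cl (cl [set u]))|.
  have := cardsID (cl (cl (cl [set u]))) (nbrs e x); rewrite card_nbrs.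
  have := subset_leq_card (subsetIr (nbrs e x) (cl (cl (cl [set u])))).
  have : #|cl (cl (cl [set u]))| <= B.+1 ^ 3.
    apply: leq_trans n3 _; rewrite expnSr leq_mul2r; apply/orP; right.
    apply: leq_trans n2 _; rewrite expnSr leq_mul2r; apply/orP; right.
    by apply: leq_trans n1 _; rewrite cards1 mul1n expn1.
  lia.
rewrite in_setD [_ \in nbrs _ _]inE => /andP[vfar exv].
have [v1 [v2 pv]] := path v exv; have [_ /andP[exv1 exv2] vv1 vv2 _] := pv.
have far z w : z \in cl [set u] -> w \in [:: v; v1; v2] -> z != w /\ ~~ e z w.
  move=> zB; rewrite !inE orbA => wv.
  have exw : e x w by move: wv => /orP[/orP[]|] /eqP->.
  suff wB : w \notin cl (cl [set u]).
    split; first by apply: contraNneq wB => <-; apply: cl_in.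
    by apply: contra wB => ezw; apply: cl_adj zB exw ezw.
  apply: contra vfar => wB.
  case/orP: wv => [/orP[]|] /eqP wE; subst w; first exact: cl_in.
    by apply: (cl_adj _ _ _ wB exv); rewrite (graph_sym eG).
  by apply: (cl_adj _ _ _ wB exv); rewrite (graph_sym eG).
have uB : u \in cl [set u] by rewrite cl_in // inE.
have u1B : u1 \in cl [set u] by apply: (cl_adj _ u); rewrite ?inE.
have u2B : u2 \in cl [set u] by apply: (cl_adj _ u); rewrite ?inE.
exists u, u1, u2, v, v1, v2; split=> // y z yu zv; apply: far zv.
by move: yu; rewrite !in_cons in_nil orbF => /or3P[] /eqP->.
Qed.

Local Open Scope ring_scope.

(** The test vector takes the values s, 1, 1 on the first path and - s, - 1, - 1 on
    the second, with s = sqrt 2: this is the eigenvector of the path for its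
    eigenvalue s.  Its entries sum to 0 and its square norm is 8, so the form of
    the non-adjacency graph is - 8 minus that of the local graph, and the latter
    is at least 8 s. *)
Lemma sqrt2_le_of_far_paths (R : realType) (alpha : R) (B : nat) x :
    (forall f : T -> R, 0 <= alpha * (\sum_v f v ^+ 2) +
       \sum_u \sum_(v | local_nonadj e x u v) f u * f v) ->
    (b 1 + 3 <= k)%N -> (k <= b 1 + B)%N -> (B.+1 ^ 3 < k)%N ->
  Num.sqrt 2 <= alpha - 1.
Proof.
move=> form a1 hB hk.
have [u [u1 [u2 [v [v1 [v2 [pu pv far]]]]]]] := far_two_paths x a1 hB hk.
have [exu /andP[exu1 exu2] uu1 uu2 u12] := pu.
have [exv /andP[exv1 exv2] vv1 vv2 v12] := pv.
have uB : u \in [:: u; u1; u2] by rewrite !inE eqxx.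
have u1B : u1 \in [:: u; u1; u2] by rewrite !inE eqxx orbT.
have u2B : u2 \in [:: u; u1; u2] by rewrite !inE eqxx !orbT.
have fv z : z \in [:: u; u1; u2] -> z != v /\ ~~ e z v.
  by move=> zu; apply: far => //; rewrite !inE eqxx.
have fv1 z : z \in [:: u; u1; u2] -> z != v1 /\ ~~ e z v1.
  by move=> zu; apply: far => //; rewrite !inE eqxx orbT.
have fv2 z : z \in [:: u; u1; u2] -> z != v2 /\ ~~ e z v2.
  by move=> zu; apply: far => //; rewrite !inE eqxx !orbT.
have neq y z : e y z -> y != z by apply: contraTneq => ->; rewrite (graph_irr eG).
have nu1 := neq _ _ uu1; have nu2 := neq _ _ uu2; have nv1 := neq _ _ vv1; have nv2 := neq _ _ vv2.
pose s : R := Num.sqrt 2.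
have s2E : s * s = 2 by rewrite -expr2 sqr_sqrtr ?ler0n.
pose I (a y : T) : R := (y == a)%:R.
pose f y := s * I u y + I u1 y + I u2 y - (s * I v y + I v1 y + I v2 y).
have fsum (H : T -> R) : \sum_y f y * H y = s * H u + H u1 + H u2 - (s * H v + H v1 + H v2).
  have dl a : \sum_y I a y * H y = H a.
    by rewrite (bigD1 a) //= /I eqxx mul1r big1 ?addr0 // => y /negPf->; rewrite mul0r.
  rewrite -!dl !mulr_sumr -!big_split -sumrN -big_split /=.
  by apply: eq_bigr => y _; rewrite /f; ring.
have f0 y : ~~ e x y -> f y = 0.
  move=> nxy; have Iy a : e x a -> I a y = 0.
    by move=> exa; rewrite /I; case: eqP => // ya; rewrite ya exa in nxy.
  by rewrite /f !Iy //; ring.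
have := sum_split_nbr drg (fun _ _ => 1 : R) f0.
have row y : \sum_(z | e y z) f z =
   s * (e y u)%:R + (e y u1)%:R + (e y u2)%:R - (s * (e y v)%:R + (e y v1)%:R + (e y v2)%:R).
  rewrite -(fsum (fun z => (e y z)%:R)) big_mkcond; apply: eq_bigr => z _.
  by case: (e y z); rewrite ?mulr1 ?mulr0.
have -> : \sum_y \sum_z f y * f z * 1 = 0.
  have F0 : \sum_y f y = 0.
    rewrite (eq_bigr (fun y => f y * 1)) => [|y _]; last by rewrite mulr1.
    by rewrite fsum; ring.
  rewrite big1 // => y _; rewrite (eq_bigr (fun z => f y * f z)) => [|z _]; last by rewrite mulr1.
  by rewrite -mulr_sumr F0 mulr0.
have -> : \sum_y f y ^+ 2 * 1 = \sum_y f y ^+ 2 by apply: eq_bigr => y _; rewrite mulr1.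
have neqE (y z : T) : y != z -> ((y == z) = false) * ((z == y) = false).
  by move=> yz; rewrite (eq_sym z) (negPf yz).
have adjE y z : e y z -> (e y z = true) * (e z y = true).
  by move=> yz; rewrite (graph_sym eG z) yz.
have nadjE y z : ~~ e y z -> (e y z = false) * (e z y = false).
  by move=> yz; rewrite (graph_sym eG z) (negPf yz).
have neqs := (neqE _ _ nu1, neqE _ _ nu2, neqE _ _ u12, neqE _ _ nv1, neqE _ _ nv2,
  neqE _ _ v12, neqE _ _ (fv u uB).1, neqE _ _ (fv1 u uB).1, neqE _ _ (fv2 u uB).1,
  neqE _ _ (fv u1 u1B).1, neqE _ _ (fv1 u1 u1B).1, neqE _ _ (fv2 u1 u1B).1,
  neqE _ _ (fv u2 u2B).1, neqE _ _ (fv1 u2 u2B).1, neqE _ _ (fv2 u2 u2B).1).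
have adjs := (graph_irr eG, adjE _ _ uu1, adjE _ _ uu2, adjE _ _ vv1, adjE _ _ vv2,
  nadjE _ _ (fv u uB).2, nadjE _ _ (fv1 u uB).2, nadjE _ _ (fv2 u uB).2,
  nadjE _ _ (fv u1 u1B).2, nadjE _ _ (fv1 u1 u1B).2, nadjE _ _ (fv2 u1 u1B).2,
  nadjE _ _ (fv u2 u2B).2, nadjE _ _ (fv1 u2 u2B).2, nadjE _ _ (fv2 u2 u2B).2).
have sq : \sum_y f y ^+ 2 = 8.
  rewrite (eq_bigr (fun y => f y * f y)) // fsum /f /I !eqxx.
  rewrite !neqs /=; transitivity (2 * (s * s) + 4); first by ring.
  by rewrite s2E; ring.
have nbr : 8 * s <= \sum_y \sum_(z | e y z) f y * f z * 1.
  rewrite (eq_bigr (fun y => f y * \sum_(z | e y z) f z)); last first.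
    by move=> y _; rewrite mulr_sumr; apply: eq_bigr => z _; rewrite mulr1.
  rewrite fsum !row !adjs (graph_sym eG u2 u1) (graph_sym eG v2 v1).
  have := ler0n R (e u1 u2); have := ler0n R (e v1 v2).
  set p := (e u1 u2)%:R; set q := (e v1 v2)%:R => q0 p0.
  rewrite -subr_ge0 [X in 0 <= X](_ : _ = 2 * (p + q)); first by lra.
  by rewrite /=; ring.
have -> : \sum_y \sum_(z | local_nonadj e x y z) f y * f z * 1 =
   \sum_y \sum_(z | local_nonadj e x y z) f y * f z.
  by apply: eq_bigr => y _; apply: eq_bigr => z _; rewrite mulr1.
have := form f; rewrite sq -/s; set G := \sum_y \sum_(z | local_nonadj e x y z) _.
by move: nbr; lra.
Qed.

End LocalGraph.

(** * Neighbourhoods with many edges *)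

Section Dense.
Variables (T : finType) (e : rel T) (b c : nat -> nat).
Hypothesis drg : distance_regular e b c.
Hypothesis D3 : 3 <= diameter e.
Let eG := drg_connected drg.
Local Notation d := (dist e).
Local Notation k := (b 0).
Local Notation N := (fun x => nbrs (local_nonadj e x)).

(** Let w be at distance 3 from x and z a neighbour of w at distance 2 from x.  The
    common neighbours of x and z are neighbours of z at distance 2 from w. *)
Lemma c2_le_b1 : c 2 <= b 1.
Proof.
have [x [y dxy]] := diameter_attained eG.
have [|w dw] := @exists_dist _ _ eG 3 x y; first by rewrite dxy.
have [z ezw dz] := dist_pred eG dw; have ewz : e w z by rewrite (graph_sym eG).
rewrite -(common_nbrs_card drg dz) -(edge_dist1 eG ewz) -(drg_b drg).
apply: subset_leq_card; apply/subsetP => u; rewrite !inE => /andP[exu ezu].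
rewrite ezu (edge_dist1 eG ewz) /=.
have euw : ~~ e u w.
  apply/negP => euw; have := dist_edge eG x euw.
  by rewrite (edge_dist1 eG exu) dw.
have uw : u != w.
  by apply/eqP => uw; move: dw; rewrite -uw (edge_dist1 eG exu).
rewrite dist_sym // (dist_common_nbr eG (z := z)) // (graph_sym eG) //.
Qed.

(** Two vertices at distance 2 with common neighbour z miss at most b_1 neighbours
    of z each, and have at most c_2 <= b_1 common neighbours. *)
Lemma k_le_b1 : k <= 3 * b 1 + 2.
Proof.
have [x [y dxy]] := diameter_attained eG.
have [|w dw] := @exists_dist _ _ eG 2 x y; first by rewrite dxy; lia.
have [z ezw dz] := dist_pred eG dw.
have ezx : e z x by rewrite (graph_sym eG) -(dist_eq1 eG) dz.
have [H _] := triangles_card drg ezx ezw.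
have : #|triangles e z x w| <= c 2.
  by rewrite -(common_nbrs_card drg dw); apply: subset_leq_card; exact: subsetIr.
by have := c2_le_b1; lia.
Qed.

(** The bound on a_1 = k - 1 - b_1: see the vertices y, x, q and x' of the
    introduction.  U and W are the common neighbours of x and x' seen from y
    and from q. *)
Lemma a1_bounded r : (forall x, form_nonneg (local_nonadj e x) 5 2) ->
    2 ^ (8 + 8) < r -> 2 ^ (8 + (6 * r + 71)) <= b 1 ->
  k <= b 1 + (3 * (8 * r + 71) + 4).
Proof.
move=> Hform hr hb; set S := 8 * r + 71.
have clusters x v : e x v -> exists Q : {set T}, [/\ v \in Q, #|N x v :\: Q| <= S,
    #|Q :\: N x v| <= r,
    forall w, w \in Q -> b 1 <= #|N x w :&: N x v| + S &
    forall w, w \notin Q -> #|N x w :&: Q| <= r /\ #|N x w :&: N x v| <= S].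
  move=> exv.
  have gX u w : local_nonadj e x u w -> u \in nbrs e x.
    by case/and4P=> exu _ _ _; rewrite inE.
  have deg u : u \in nbrs e x -> #|N x u| = b 1.
    by rewrite inE => /(card_local_nonadj drg).
  have cX : #|nbrs e x| <= 3 * b 1 + 3 by rewrite (card_nbrs drg); have := k_le_b1; lia.
  have vX : v \in nbrs e x by rewrite inE.
  exact: (local_clusters (local_nonadj_sym drg x)
    (@local_nonadj_irr _ e x) (Hform x) gX deg cX hr hb vX).
have rS : r <= S by rewrite /S; lia.
have d_big : 3 * S < b 1.
  apply: leq_trans hb; rewrite expnD.
  by have := ltn_expl (6 * r + 71) (isT : 1 < 2); rewrite /S; lia.
rewrite leqNgt; apply/negP => big.
have /card_gt0P[y _] := graph_nonempty eG.
have /card_gt0P[x] : 0 < #|nbrs e y| by rewrite (card_nbrs drg); lia.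
rewrite inE => eyx; have [Q [xQ NQ QN Qin Qout]] := clusters y x eyx.
(* a_1 exceeds the number of vertices of Q that are adjacent to x. *)
have /card_gt0P[q] : 0 < #|nbrs e y :\: (N y x :|: Q)|.
  have : #|nbrs e y| <= #|nbrs e y :\: (N y x :|: Q)| + (#|N y x| + #|Q :\: N y x|).
    apply: leq_trans (leq_add (leqnn _) (leq_card_setU _ _)).
    apply: leq_trans (leq_card_setU _ _); apply: subset_leq_card.
    by apply/subsetP => z; rewrite !inE; case: (z \in Q); case: local_nonadj => /=; rewrite ?orbT ?orbF.
  rewrite (card_nbrs drg) (card_local_nonadj drg) //; lia.
rewrite in_setD in_setU negb_or !in_nbrs => /andP[/andP[nxq qQ] eyq].
have xq : x != q by apply: contraNneq qQ => <-.
have exq : e x q by move: nxq; rewrite /local_nonadj eyx eyq xq /= negbK.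
have eqx : e q x by rewrite (graph_sym eG).
have [P [xP NP _ Pin _]] := clusters q x eqx.
have [qr qS] := Qout q qQ.
(* Candidates for x': those of the cluster that are adjacent to q. *)
pose X := (N y x :&: Q) :\: N y q.
have XN : X \subset N q x.
  apply/subsetP => z; rewrite /X !(in_setD, in_setI, in_nbrs).
  move=> /andP[nqz /andP[/and4P[_ eyz xz nxz] zQ]].
  have qz : q != z by apply: contraNneq qQ => ->.
  have eqz : e q z by move: nqz; rewrite /local_nonadj eyq eyz qz /= negbK.
  by rewrite /local_nonadj eqx eqz xz nxz.
have /card_gt0P[x'] : 0 < #|X :&: P|.
  have h1 := cardsID Q (N y x); rewrite (card_local_nonadj drg) // in h1.
  have h2 := cardsID (N y q) (N y x :&: Q).
  have h3 : #|(N y x :&: Q) :&: N y q| <= #|N y q :&: Q|.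
    by apply: subset_leq_card; apply/subsetP => z; rewrite !in_setI => /andP[/andP[_ ->] ->].
  have h4 := cardsID P X.
  have h5 : #|X :\: P| <= #|N q x :\: P| by apply: subset_leq_card; apply: setSD.
  rewrite -/X in h2; clear -h1 h2 h3 h4 h5 NQ qr NP d_big rS; lia.
rewrite /X !(in_setD, in_setI, in_nbrs) => /andP[X' x'P].
have := subsetP XN x'; rewrite /X !(in_setD, in_setI, in_nbrs) => /(_ X').
case/and4P=> _ eqx' xx' nxx'.
move: X' => /andP[_ /andP[/and4P[_ eyx' _ _] x'Q]].
have dxx' : d x x' = 2.
  by apply: (dist_common_nbr eG (z := y)); rewrite // (graph_sym eG).
have := triangles_card drg eyx' eyx; have := triangles_card drg eqx' eqx.
have := triangles_card drg eyq eyx.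
move=> [_ tq] [tW _] [tU _].
have := Qin x' x'Q; have := Pin x' x'P; move=> hP hQ.
set U := triangles e y x' x in tU; set W := triangles e q x' x in tW.
have sUW : U :&: W \subset triangles e y q x.
  by apply/subsetP => z; rewrite !inE => /andP[/and3P[-> _ ->] /andP[->]].
have sC : U :|: W \subset nbrs e x :&: nbrs e x'.
  by apply/subsetP => z; rewrite !inE => /orP[] /and3P[_ -> ->].
have cC := subset_leq_card sC; rewrite (common_nbrs_card drg) // in cC.
have cUW := subset_leq_card sUW; have cI := cardsUI U W; have c2b := c2_le_b1.
have leU : k <= #|U| + b 1 + S + 2 by clear -tU hQ; lia.
have leW : k <= #|W| + b 1 + S + 2 by clear -tW hP; lia.
have leZ : #|U :&: W| + 2 * b 1 <= k + S by clear -tq qS cUW; lia.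
clear -leU leW leZ cI cC c2b big; lia.
Qed.

End Dense.

(** * Conclusion *)

Lemma local_form_int (R : realType) (T : finType) (g : rel T) (alpha : R) :
    (alpha <= 5 / 2)%R ->
    (forall f : T -> R, 0 <= alpha * (\sum_v f v ^+ 2) +
       \sum_u \sum_(v | g u v) f u * f v)%R ->
  form_nonneg g 5 2.
Proof.
move=> a52 form f; have := form (fun v => (f v)%:~R%R).
rewrite -(ler0z R) rmorphD !rmorphM /= !rmorph_sum /=.
set S := (\sum_v _)%R; set G := (\sum_u _)%R => h.
have -> : (\sum_i (f i ^+ 2)%:~R = S :> R)%R.
  by apply: eq_bigr => v _; rewrite rmorphXn.
have -> : (\sum_i (\sum_(v | g i v) f i * f v)%:~R = G :> R)%R.
  apply: eq_bigr => u _; rewrite rmorph_sum; apply: eq_bigr => v _.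
  by rewrite rmorphM.
have S0 : (0 <= S)%R by apply: sumr_ge0 => v _; rewrite sqr_ge0.
have : (0 <= (5 / 2 - alpha) * S)%R by rewrite mulr_ge0 // subr_ge0.
rewrite -!pmulrn; move: h; lra.
Qed.

Local Open Scope ring_scope.

Theorem theorem1p3 (R : realType) (alpha : R)
    (alpha_gt0 : 0 < alpha) (alpha_lt : alpha < 1 + Num.sqrt 2) :
  exists K : nat,
    forall (T : finType) (e : rel T) (b c : nat -> nat) (theta : R),
      distance_regular e b c ->
      (3 <= diameter e)%N ->
      (K <= b 0%N)%N ->
      (2 <= a_number b c 1)%N ->
      smallest_eigenvalue e theta ->
      theta <= - 1 - (b 1%N)%:R / alpha ->
      (diameter e = 3%N /\
        [\/ graph_iso e icosahedron /\
            has_intersection_array e [:: 5; 2; 1]%N [:: 1; 2; 5]%N,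
            graph_iso e johnson_6_3 /\
            has_intersection_array e [:: 9; 4; 1]%N [:: 1; 4; 9]%N,
            graph_iso e (distance_graph halved_6_cube 2) /\
            has_intersection_array e [:: 15; 8; 1]%N [:: 1; 8; 15]%N |
            is_gosset e /\
            has_intersection_array e [:: 27; 16; 1]%N [:: 1; 16; 27]%N]) \/
      (diameter e = 4%N /\
        is_conway_smith e /\
        has_intersection_array e [:: 10; 6; 4; 1]%N [:: 1; 2; 6; 10]%N).
Proof.
have [r hr] : exists r, (2 ^ (8 + 8) < r)%N by exists (2 ^ (8 + 8)).+1; exact: leqnn.
pose B := (3 * (8 * r + 71) + 4)%N; pose M := (2 ^ (8 + (6 * r + 71)))%N.
exists (3 * M + 3 + B.+1 ^ 3)%N => T e b c theta drg D3 kK a2 [ev _] tle.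
(* The valency is too large for any of the listed graphs to occur. *)
exfalso.
have D2 : (2 <= diameter e)%N by exact: ltnW.
have c1E := c1_eq1 drg D2.
have k3 := k_le_b1 drg D3.
have hM : (M <= b 1%N)%N.
  rewrite leqNgt; apply/negP => lt; move: kK; rewrite leqNgt => /negP[].
  apply: leq_ltn_trans k3 _; clear -lt; lia.
have form x := local_form drg D2 x ev alpha_gt0 tle.
have a52 : alpha <= 5 / 2.
  have : Num.sqrt 2 <= 3 / 2 :> R.
    rewrite -[leRHS]ger0_norm; last by lra.
    by rewrite -sqrtr_sqr ler_sqrt; lra.
  by move: alpha_lt; lra.
have kB := a1_bounded drg D3 (fun x => local_form_int a52 (form x)) hr hM.
have [x _] := diameter_attained (drg_connected drg).
have a1 : (b 1 + 3 <= b 0)%N by move: a2; rewrite /a_number c1E; lia.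
have kbig : (B.+1 ^ 3 < b 0%N)%N.
  by apply: leq_trans kK; rewrite addnC addnA addn3 ltnS leqW // leqW // leq_addr.
have := sqrt2_le_of_far_paths drg (form x) a1 kB kbig.
by move: alpha_lt; lra.
Qed.
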